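(* Let $u$ be the exact solution of $\partial_t u=Lu$ and let $u_h^{n+1}=R_s(\tau L_h)u_h^n$ be the fully discrete scheme, and suppose the assumptions of regularity of $u$ (R), fully discrete stability (FS), consistency of the RK method (RK) and consistency in space (C), listed in the context, hold. Then, with $t^n=n\tau$, the fully discrete scheme satisfies the error estimate $$\|u(t^n)-u_h^n\|\le e^{\mu_h t^n}\|\Pi u(0)-u_h^0\|+E_0(h)+C_\star\,\sigma(\mu_h,t^n)\left(\sum_{i=1}^{p+1}\tau^{i-1}E_i(h)+\sup_t\|\partial_t^{p+1}u\|\,\tau^p\right),$$ where $C_\star=2\sum_{i=0}^s|\alpha_i|$.
   Context: Setting. $\Omega\subset\mathbb{R}^d$ and $V=L^2(\Omega;\mathbb{R}^m)$ with its inner product $\langle\cdot,\cdot\rangle$ and norm $\|\cdot\|$. $L=\sum_{|\alpha|\le q}a_\alpha(x)D^\alpha$ is a linear differential operator of order $q$ in $x$. $u=u(x,t)$, with values in $\mathbb{R}^m$, satisfies $\partial_t u=Lu$; write $u(t)=u(\cdot,t)\in V$. $V_h\subset V$ is the (finite-dimensional) space of discrete solutions and $L_h:V_h\to V_h$ is a linear operator approximating $L$, with operator norm $\|L_h\|$ induced by $\|\cdot\|$. For real constants $\alpha_0,\dots,\alpha_s$, determined by an explicit Runge--Kutta (RK) method with $s$ stages, set $R_s(\tau L_h)=\sum_{i=0}^s\alpha_i(\tau L_h)^i$. The fully discrete solution is $u_h^{n+1}=R_s(\tau L_h)u_h^n$ with given $u_h^0\in V_h$ and uniform time step $\tau>0$.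 Standing conventions: $\tau\le1$ and $\tau\|L_h\|\le\lambda<1$. $\sup_t$ is over $t\ge 0$. For $a\ge0$: $\sigma(a,t)=(e^{at}-1)/a$ if $a>0$, and $\sigma(0,t)=t$. The symbol $\Pi$ denotes the operator in (C). (R) With the integer $p\ge 1$ from (RK), $u$ is sufficiently smooth, such that $\partial_t^iu$ and $L^iu$ ($1\le i\le p+1$) and $\Pi\partial_t^iu(\cdot,t)$ ($0\le i\le p+1$) are well-defined and bounded in $L^\infty$ norm, and $\partial_t^iu=L^iu$ for all $1\le i\le p+1$. (FS) There is a constant $\mu_h\ge0$ such that $\|R_s(\tau L_h)\|\le1+\mu_h\tau$ under the time step constraint $\tau\|L_h\|\le\lambda$; here $\lambda$ can either be a constant or depend on the mesh size $h$. (RK) The RK method is $p$th order accurate, $p\ge1$: $\alpha_i=1/i!$ for all $0\le i\le p$ and $\alpha_{p+1}\ne 1/(p+1)!$ (with $\alpha_i=0$ for $i>s$). (C) There exists a linear operator $\Pi$, acting on sufficiently smooth functions of $x$, with range contained in $V_h$ ($\Pi^2=\Pi$ is not required), such that for all $t$: $\|(I-\Pi)L^iu(t)\|\le E_{\rm T}(i,t,h)$ for $0\le i\le p+1$, and $|\langle(L-L_h\Pi)L^{i-1}u(t),v_h\rangle|\le E_{\rm S}(i,t,h)\|v_h\|$ for all $v_h\in V_h$ and $1\le i\le p+1$. Set $E_0(h)=\sup_tE_{\rm T}(0,t,h)$ and $E_i(h)=\sup_t\big(E_{\rm S}(i,t,h)+E_{\rm T}(i,t,h)\big)$ for $i\g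e1$.
   Formalization: The formal theorem additionally assumes that Π commutes with the time derivative: t ↦ Π∂_t^i u(·,t) is differentiable in L² with derivative Π∂_t^{i+1}u for 0≤i≤p; for an arbitrary linear Π without this the estimate fails. E_S≥0 is also stated explicitly. *)

(* Defs.v *)
From HB Require Import structures.
From mathcomp Require Import all_boot all_order all_algebra.
From mathcomp Require Import all_classical all_reals all_analysis.

Set Implicit Arguments.
Unset Strict Implicit.
Unset Printing Implicit Defensive.

Import Order.TTheory GRing.Theory Num.Theory.
Import numFieldNormedType.Exports.

Local Open Scope classical_set_scope.
Local Open Scope ring_scope.

(* R^n is 'rV[R]_n with the product sigma-algebra, that is, the one generated by
   the coordinate maps. *)
Definition rV_display : measure_display. Proof. exact. Qed.

Section rV_measurable.
Context {R : realType} (n : nat).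

Definition rV_measurable : set (set 'rV[R]_n) :=
  <<s \bigcup_(i in [set: 'I_n])
        preimage_set_system setT (fun x : 'rV[R]_n => x 0 i) measurable >>.

Let rV_measurable0 : rV_measurable set0.
Proof. exact: sigma_algebra0. Qed.

Let rV_measurableC A : rV_measurable A -> rV_measurable (~` A).
Proof. exact: sigma_algebraC. Qed.

Let rV_measurable_bigcup (F : (set 'rV[R]_n)^nat) :
  (forall i, rV_measurable (F i)) -> rV_measurable (\bigcup_i F i).
Proof. exact: sigma_algebra_bigcup. Qed.

HB.instance Definition _ := @isMeasurable.Build rV_display
  'rV[R]_n rV_measurable rV_measurable0 rV_measurableC rV_measurable_bigcup.

End rV_measurable.


Section rV_measurable_lemmas.
Context {R : realType}.

Lemma measurable_rV_coord n (i : 'I_n) :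
  measurable_fun setT (fun x : 'rV[R]_n => x 0 i : measurableTypeR R).
Proof.
move=> _ B mB; rewrite setTI; apply: sub_sigma_algebra.
by exists i => //; exists B => //; rewrite setTI.
Qed.

Lemma measurable_fun_rV d (T : measurableType d) n (f : T -> 'rV[R]_n) :
  (forall i, measurable_fun setT (fun t => f t 0 i : measurableTypeR R)) ->
  measurable_fun setT f.
Proof.
move=> mf; pose G := \bigcup_(i in [set: 'I_n])
  preimage_set_system setT (fun x : 'rV[R]_n => x 0 i) measurable.
apply: (measurability G) => // _ [_ [i _ [A mA <-]] <-].
by have := mf i measurableT A mA; rewrite !setTI.
Qed.

End rV_measurable_lemmas.

Section rV_lebesgue_step.
Context {R : realType} (n : nat).
Variable mu : {sigma_finite_measure set 'rV[R]_n -> \bar R}.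

Definition rV_cons (z : measurableTypeR R * 'rV[R]_n) : 'rV[R]_n.+1 :=
  row_mx (z.1 : R)%:M z.2.

Let rV_uncons (x : 'rV[R]_n.+1) : measurableTypeR R * 'rV[R]_n :=
  (x 0 0, @rsubmx R 1 1 n x).

Let rV_consK : cancel rV_cons rV_uncons.
Proof.
move=> [a b]; rewrite /rV_uncons /rV_cons/=; congr pair; last exact: row_mxKr.
by rewrite mxE; case: splitP => // k _; rewrite ord1 mxE.
Qed.

Let measurable_rV_cons : measurable_fun setT rV_cons.
Proof.
apply: measurable_fun_rV => i; case: (@splitP 1 n i) => j ij.
  rewrite (_ : (fun _ => _) = fst)//; apply/funext => -[a b].
  rewrite /rV_cons mxE; case: splitP => k; rewrite ij.
    by move=> _; rewrite [k]ord1 mxE.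
  by move=> jk; have := ltn_ord j; rewrite jk.
rewrite (_ : (fun _ => _) = (fun x : 'rV[R]_n => x 0 j) \o snd).
  exact: (measurableT_comp (@measurable_rV_coord _ _ j)).
apply/funext => -[a b].
rewrite /rV_cons mxE; case: splitP => k; rewrite ij.
  by move=> jk; have := ltn_ord k; rewrite -jk.
by move/addnI/ord_inj => ->.
Qed.

Let measurable_rV_uncons : measurable_fun setT rV_uncons.
Proof.
apply/measurable_fun_pair; first exact: measurable_rV_coord.
apply: measurable_fun_rV => i; rewrite (_ : (fun _ => _) =
    (fun x : 'rV[R]_n.+1 => x 0 (rshift 1 i))); last first.
  by apply/funext => x; rewrite mxE.
exact: measurable_rV_coord.
Qed.

Definition rV_lebesgue_step : set 'rV[R]_n.+1 -> \bar R :=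
  pushforward (lebesgue_measure \x mu)%E rV_cons.

Let rV_lebesgue_step0 : rV_lebesgue_step set0 = 0%E.
Proof. by rewrite /rV_lebesgue_step/pushforward preimage_set0 measure0. Qed.

Let rV_lebesgue_step_ge0 A : (0 <= rV_lebesgue_step A)%E.
Proof. exact: measure_ge0. Qed.

Let mpre A : measurable A -> measurable (rV_cons @^-1` A).
Proof.
by move=> mA; rewrite -[X in measurable X]setTI; exact: measurable_rV_cons.
Qed.

Let rV_lebesgue_step_additive : semi_sigma_additive rV_lebesgue_step.
Proof.
move=> F mF tF mUF; rewrite /rV_lebesgue_step/pushforward preimage_bigcup.
apply: measure_semi_sigma_additive.
- by move=> k; exact: mpre.
- apply/trivIsetP => /= i j _ _ ij; rewrite -preimage_setI.
  by move/trivIsetP : tF => /(_ _ _ _ _ ij) ->//; rewrite preimage_set0.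
- by rewrite -preimage_bigcup; exact: mpre.
Qed.

HB.instance Definition _ := isMeasure.Build _ _ _ rV_lebesgue_step
  rV_lebesgue_step0 rV_lebesgue_step_ge0 rV_lebesgue_step_additive.

Let rV_lebesgue_step_sigma_finite : sigma_finite setT rV_lebesgue_step.
Proof.
have /sigma_finiteP[F [FT ndF Foo]] :=
  sigma_finiteT (@lebesgue_measure R : sigma_finite_measure _ _).
have /sigma_finiteP[G [GT ndG Goo]] := sigma_finiteT mu.
exists (fun k => rV_uncons @^-1` (F k `*` G k)).
  apply/esym; rewrite -subTset => x _.
  have [i _ Fi] : (\bigcup_i F i) (rV_uncons x).1 by rewrite -FT.
  have [j _ Gj] : (\bigcup_i G i) (rV_uncons x).2 by rewrite -GT.
  exists (maxn i j) => //; split => /=.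
    by move: Fi; exact/subsetPset/ndF/leq_maxl.
  by move: Gj; exact/subsetPset/ndG/leq_maxr.
move=> k; have [mF Fk] := Foo k; have [mG Gk] := Goo k.
have mFG : measurable (F k `*` G k) by exact: measurableX.
split; first by rewrite -[X in measurable X]setTI; exact: measurable_rV_uncons.
rewrite /rV_lebesgue_step/pushforward -comp_preimage.
rewrite (_ : rV_uncons \o rV_cons = id); last exact/funext/rV_consK.
by rewrite preimage_id product_measure1E// lte_mul_pinfty// ge0_fin_numE.
Qed.

HB.instance Definition _ := Measure_isSigmaFinite.Build _ _ _ rV_lebesgue_step
  rV_lebesgue_step_sigma_finite.

End rV_lebesgue_step.

(* n-dimensional Lebesgue measure, as the n-fold product of lebesgue_measure. *)
Fixpoint rV_lebesgue {R : realType} (n : nat) :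
    {sigma_finite_measure set 'rV[R]_n -> \bar R} :=
  match n with
  | 0%N => \d_(0 : 'rV[R]_0)
  | n'.+1 => rV_lebesgue_step (rV_lebesgue n')
  end.

Section setting.
Context {R : realType} {d m : nat}.

(* A function on Omega is represented by a total function of which only the
   values on Omega matter. *)
Local Notation field := ('rV[R]_d -> 'cV[R]_m).
Implicit Types (Omega : set 'rV[R]_d) (f g v : field) (u : R -> field).
Implicit Types (Vh Dom : set field) (A L Lh Pi : field -> field).

(* L^2(Omega; R^m). As usual, elements are functions, and almost everywhere
   equal functions are not separated by dotL2 and normL2. Both are meaningful
   only on in_L2: outside of it the integral may take a default value. *)
Definition in_L2 Omega f : Prop :=
  (forall j, measurable_fun Omega (fun x => f x j 0)) /\
  (\int[rV_lebesgue d]_(x in Omega) (\sum_j f x j 0 ^+ 2)%:E < +oo)%E.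

Definition dotL2 Omega f g : R :=
  \int[rV_lebesgue d]_(x in Omega) (\sum_j f x j 0 * g x j 0).

Definition normL2 Omega f : R := Num.sqrt (dotL2 Omega f f).

Definition opnorm Omega Vh A : \bar R :=
  ereal_sup [set (normL2 Omega (A v))%:E
            | v in [set v | Vh v /\ normL2 Omega v <= 1]].

Definition fin_dim_subspace Vh : Prop :=
  exists (N : nat) (phi : 'I_N -> field),
    Vh = [set v | exists c : 'I_N -> R, v = \sum_i c i *: phi i].

Definition linear_on (D : set field) A : Prop :=
  forall a v w, D v -> D w -> A (a *: v + w) = a *: A v + A w.

Definition partial (i : 'I_d) f : field :=
  fun x => 'D_(delta_mx 0 i) f x.

Definition Dmulti q (al : {ffun 'I_d -> 'I_q.+1}) f : field :=
  foldr (fun i g => iter (al i) (partial i) g) f (enum 'I_d).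

(* Every multi-index of length at most q is a function 'I_d -> 'I_q.+1. *)
Definition diffop q (a : {ffun 'I_d -> 'I_q.+1} -> 'rV[R]_d -> 'M[R]_m) f :
    field :=
  fun x => \sum_(al : {ffun 'I_d -> 'I_q.+1} | (\sum_i al i <= q)%N)
             a al x *m Dmulti al f x.

(* All iterated partial derivatives of order at most q exist on Omega. *)
Definition has_partials Omega q f : Prop :=
  forall (s : seq 'I_d) (i : 'I_d) x, (size s < q)%N -> Omega x ->
    derivable (foldr partial f s) x (delta_mx 0 i).

(* Increments h of the time t with t + h >= 0: the derivative in time is
   two-sided for t > 0 and one-sided at t = 0. *)
Definition time_incr (t : R) : set_system R :=
  within [set h | 0 <= t + h] 0^'.

Definition has_dt Omega u : Prop :=
  forall t x, 0 <= t -> Omega x ->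
    cvg (h^-1 *: (u (t + h) x - u t x) @[h --> time_incr t]).

Definition dt u : R -> field :=
  fun t x => lim (h^-1 *: (u (t + h) x - u t x) @[h --> time_incr t]).

Definition Linfty_bounded Omega u : Prop :=
  exists M : R, forall t, 0 <= t ->
    {ae rV_lebesgue d, forall x, Omega x -> `|u t x| <= M}.

Definition exact_solution Omega L u : Prop :=
  [/\ forall t, 0 <= t -> in_L2 Omega (u t),
      has_dt Omega u &
      forall t x, 0 <= t -> Omega x -> dt u t x = L (u t) x].

(* Dom plays the part of the "sufficiently smooth" functions of x. *)
Record smooth_to_discrete Omega Dom Vh Pi : Prop := SmoothToDiscrete {
  std_dom0 : Dom 0;
  std_domD : forall a f g, Dom f -> Dom g -> Dom (a *: f + g);
  std_linear : linear_on Dom Pi;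
  std_range : forall f, Dom f -> Vh (Pi f);
  std_restr : forall f g, Dom f -> {in Omega, f =1 g} -> Dom g /\ Pi g = Pi f
}.

(* In reg_Pi_dt, Pi acts on x only and commutes with the time derivative, which
   is taken in L^2: d/dt (Pi u^(i)) = Pi u^(i+1). This has to be stated, since
   Pi is merely linear (interpolation and Gauss-Radau operators are not
   continuous on L^2) and a discontinuous Pi need not commute with limits. *)
Record regular Omega q L Dom Pi (p : nat) u : Prop := Regular {
  reg_has_dt : forall i, (i <= p)%N -> has_dt Omega (iter i dt u);
  reg_has_L : forall i t, (i <= p)%N -> 0 <= t ->
    has_partials Omega q (iter i L (u t));
  reg_L2 : forall i t, (i <= p.+1)%N -> 0 <= t ->
    in_L2 Omega (iter i L (u t));
  reg_dom : forall i t, (i <= p.+1)%N -> 0 <= t -> Dom (iter i dt u t);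
  reg_Pi_dt : forall i t, (i <= p)%N -> 0 <= t ->
    normL2 Omega (h^-1 *: (Pi (iter i dt u (t + h)) - Pi (iter i dt u t))
                  - Pi (iter i.+1 dt u t)) @[h --> time_incr t] --> (0 : R);
  reg_dt_bounded : forall i, (0 < i <= p.+1)%N ->
    Linfty_bounded Omega (iter i dt u);
  reg_L_bounded : forall i, (0 < i <= p.+1)%N ->
    Linfty_bounded Omega (fun t => iter i L (u t));
  reg_Pi_bounded : forall i, (i <= p.+1)%N ->
    Linfty_bounded Omega (fun t => Pi (iter i dt u t));
  reg_dtL : forall i t x, (0 < i <= p.+1)%N -> 0 <= t -> Omega x ->
    iter i dt u t x = iter i L (u t) x
}.

Definition RK_step (s : nat) (alpha : nat -> R) (tau : R) Lh v : field :=
  \sum_(i < s.+1) alpha i *: iter i (fun w => tau *: Lh w) v.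

Definition RK_order (s : nat) (alpha : nat -> R) (p : nat) : Prop :=
  [/\ forall i, (s < i)%N -> alpha i = 0,
      forall i, (i <= p)%N -> alpha i = (i`!%:R)^-1 &
      alpha p.+1 != (p.+1`!%:R)^-1].

Definition fully_discrete_stable Omega Vh Lh s alpha (lambda mu : R) : Prop :=
  0 <= mu /\
  forall tau : R, 0 < tau <= 1 -> (tau%:E * opnorm Omega Vh Lh <= lambda%:E)%E ->
    (opnorm Omega Vh (RK_step s alpha tau Lh) <= (1 + mu * tau)%:E)%E.

(* Nonnegativity of ES i t only matters when every element of Vh has zero norm,
   as it otherwise follows from spc_S. *)
Record space_consistent Omega L Vh Lh Pi (p : nat) u (ET ES : nat -> R -> R) :
    Prop := SpaceConsistent {
  spc_T : forall i t, (i <= p.+1)%N -> 0 <= t ->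
    normL2 Omega (iter i L (u t) - Pi (iter i L (u t))) <= ET i t;
  spc_S_ge0 : forall i t, (0 < i <= p.+1)%N -> 0 <= t -> 0 <= ES i t;
  spc_S : forall i t v, (0 < i <= p.+1)%N -> 0 <= t -> Vh v ->
    `|dotL2 Omega (L (iter i.-1 L (u t)) - Lh (Pi (iter i.-1 L (u t)))) v|
      <= ES i t * normL2 Omega v
}.

End setting.

Definition sup_time {R : realType} (f : R -> R) : \bar R :=
  ereal_sup [set (f t)%:E | t in [set t | 0 <= t]].

Definition space_error {R : realType} (ET ES : nat -> R -> R) (i : nat) :
    \bar R :=
  if i == 0%N then sup_time (ET 0%N)
  else sup_time (fun t => ES i t + ET i t).

Definition sigma {R : realType} (a t : R) : R :=
  if a == 0 then t else (expR (a * t) - 1) / a.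

(* Main.v *)
Require Import Defs.
From mathcomp Require Import all_boot all_order all_algebra.
From mathcomp Require Import all_classical all_reals all_analysis.
From mathcomp Require Import ring lra.

(** The error splits into [u - Pi u], which [ET 0] bounds, and
    [z n = Pi u(t_n) - uh n], which lives in the discrete space. As the scheme is
    linear, [z n.+1 = R (z n) + rho], where [R] is the Runge-Kutta operator and
    [rho = Pi u(t + tau) - R (Pi u(t))], for [t = t_n], is the error of one step
    started from [Pi u(t)]. Stability gives
    [|z n.+1| <= (1 + mu tau) |z n| + |rho|], and a discrete Gronwall argument ([discrete_gronwall]) turns a bound on [|rho|] into
    the exponential and the factor [sigma] of the estimate.

    The heart is the bound on [rho] ([truncation_error_le]). Put
    [B v = tau Lh v], a contraction of the discrete space by the time step
    constraint, and [w i = tau^i Pi u^(i)(t)]. Three facts combine.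

    - [Pi] commutes with the time derivative, so that [Pi u(t + tau)] is the
      Taylor sum of the [w i / i!], [i <= p], up to
      [tau^(p+1) / (p+1)! sup |Pi u^(p+1)|] ([seminorm_taylor]).
    - Consistency in space makes [w i.+1 - B (w i)] small
      ([space_residual_le]): the time derivatives of [u] are the powers of [L]
      applied to [u], and a residual of the discrete space is estimated by
      testing it against itself.
    - These defects telescope in [w i - B^i (w 0)] ([seminorm_defect_le]), so that
      the terms of [R (Pi u(t))] of index at most [p], whose coefficients are the
      [1 / i!], match the Taylor sum. The terms of larger index are small since
      [|B^i (w 0)| <= |B^(p+1) (w 0)|], which is [|w p.+1|] up to a defect
      ([local_error_le]).

    Everything takes place in a space with a semi-inner product: the elements of
    L2 are functions, and a nonzero one may have norm zero. That the pairing is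
    bilinear on L2 rests on the integrability of products of square integrable
    functions ([semi_inner_L2]). *)

Set Implicit Arguments.
Unset Strict Implicit.
Unset Printing Implicit Defensive.

Import Order.TTheory GRing.Theory Num.Theory.
Import numFieldNormedType.Exports.

Local Open Scope classical_set_scope.
Local Open Scope ring_scope.

(** * Semi-inner products *)

Section SemiInnerProduct.
Context {R : realType} {E : lmodType R}.
Implicit Types (D V : set E) (dot : E -> E -> R).

Definition subspace D : Prop :=
  D 0 /\ forall a f g, D f -> D g -> D (a *: f + g).

Definition linear_within D (A : E -> E) : Prop :=
  forall a v w, D v -> D w -> A (a *: v + w) = a *: A v + A w.

Record semi_inner D dot : Prop := SemiInner {
  sip_sub : subspace D;
  sipC : forall f g, D f -> D g -> dot f g = dot g f;
  sip_linear : forall a f g h, D f -> D g -> D h ->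
    dot (a *: f + g) h = a * dot f h + dot g h;
  sip_ge0 : forall f, D f -> 0 <= dot f f
}.

Definition seminorm dot f : R := Num.sqrt (dot f f).

Section Subspace.
Context {D : set E} (sD : subspace D).

Lemma subspaceZ a f : D f -> D (a *: f).
Proof. by move=> Df; rewrite -[_ *: _]addr0; apply: sD.2 => //; exact: sD.1. Qed.

Lemma subspaceD f g : D f -> D g -> D (f + g).
Proof. by move=> Df Dg; rewrite -[f]scale1r; exact: sD.2. Qed.

Lemma subspaceB f g : D f -> D g -> D (f - g).
Proof.
by move=> Df Dg; apply: subspaceD => //; rewrite -scaleN1r; exact: subspaceZ.
Qed.

Lemma subspace_sum n (F : 'I_n -> E) :
  (forall i, D (F i)) -> D (\sum_(i < n) F i).
Proof.
by move=> DF; elim/big_ind: _ => //; [exact: sD.1|exact: subspaceD].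
Qed.

Context {A : E -> E} (lA : linear_within D A).

Lemma linear_within0 : A 0 = 0.
Proof.
have /eqP := lA 1 sD.1 sD.1.
by rewrite !scale1r addr0 -subr_eq subrr eq_sym => /eqP.
Qed.

Lemma linear_withinZ a f : D f -> A (a *: f) = a *: A f.
Proof.
by move=> Df; rewrite -[a *: f]addr0 lA//; [rewrite linear_within0 addr0|exact: sD.1].
Qed.

Lemma linear_withinB f g : D f -> D g -> A (f - g) = A f - A g.
Proof.
by move=> Df Dg; rewrite addrC -scaleN1r lA// scaleN1r addrC.
Qed.

End Subspace.

Section Seminorm.
Context {D : set E} {dot : E -> E -> R} (sip : semi_inner D dot).
Let sD := sip_sub sip.
Local Notation nrm := (seminorm dot).

Lemma dotDl f g h : D f -> D g -> D h -> dot (f + g) h = dot f h + dot g h.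
Proof. by move=> Df Dg Dh; rewrite -[f]scale1r (sip_linear sip)// mul1r scale1r. Qed.

Lemma dot0l h : D h -> dot 0 h = 0.
Proof.
move=> Dh; have /eqP := dotDl sD.1 sD.1 Dh.
by rewrite addr0 -subr_eq subrr eq_sym => /eqP.
Qed.

Lemma dotZl a f h : D f -> D h -> dot (a *: f) h = a * dot f h.
Proof.
move=> Df Dh; rewrite -[a *: f]addr0 (sip_linear sip)//; last exact: sD.1.
by rewrite dot0l// addr0.
Qed.

Lemma dotBl f g h : D f -> D g -> D h -> dot (f - g) h = dot f h - dot g h.
Proof.
move=> Df Dg Dh; rewrite dotDl//; last by rewrite -scaleN1r; exact: subspaceZ.
by rewrite -scaleN1r dotZl// mulN1r.
Qed.

Lemma dot_suml n (c : 'I_n -> R) (F : 'I_n -> E) h :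
  (forall i, D (F i)) -> D h ->
  dot (\sum_(i < n) c i *: F i) h = \sum_(i < n) c i * dot (F i) h.
Proof.
move=> DF Dh; suff [] : D (\sum_(i < n) c i *: F i) /\
  dot (\sum_(i < n) c i *: F i) h = \sum_(i < n) c i * dot (F i) h by [].
elim/big_rec2: _ => [|i x y _ [Dy <-]]; first by split; [exact: sD.1|exact: dot0l].
by split; [exact: sD.2|rewrite (sip_linear sip)].
Qed.

Lemma seminorm_ge0 f : 0 <= nrm f.
Proof. exact: sqrtr_ge0. Qed.

Lemma sqr_seminorm f : D f -> nrm f ^+ 2 = dot f f.
Proof. by move=> Df; rewrite sqr_sqrtr// (sip_ge0 sip). Qed.

Lemma seminorm0 : nrm 0 = 0.
Proof. by rewrite /seminorm dot0l ?sqrtr0//; exact: sD.1. Qed.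

(** The quadratic form [|x f - y g|^2] in [x] and [y] is nonnegative. When both
    norms are positive, its value at [x = |g|], [y = |f|] gives the claim. A
    norm may vanish on a nonzero element; the form is then affine in one of the
    variables, so that a positive [<f, g>] would make it negative somewhere. *)
Lemma dot_le_seminorm f g : D f -> D g -> dot f g <= nrm f * nrm g.
Proof.
move=> Df Dg.
have quad x y : 0 <= x ^+ 2 * dot f f - 2 * x * y * dot f g + y ^+ 2 * dot g g.
  have Dxf := subspaceZ sD x Df; have Dyg := subspaceZ sD y Dg.
  have := sip_ge0 sip (subspaceB sD Dxf Dyg).
  have Dd := subspaceB sD Dxf Dyg.
  rewrite dotBl// (sipC sip Dxf Dd) (sipC sip Dyg Dd) !dotBl//.
  rewrite !dotZl// (sipC sip Df Dxf) (sipC sip Dg Dxf) (sipC sip Df Dyg).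
  rewrite (sipC sip Dg Dyg) !dotZl// (sipC sip Dg Df).
  by congr (_ <= _); ring.
have nf := seminorm_ge0 f; have ng := seminorm_ge0 g.
rewrite -!sqr_seminorm// in quad.
move: nf ng quad; move: (nrm f) (nrm g) (dot f g) => F G c F0 G0 quad.
have [GG|G_gt0] := leP G 0.
  have {GG G0} G0 : G = 0 by apply/eqP; rewrite eq_le GG.
  rewrite G0 mulr0 leNgt; apply/negP => c0.
  (* The second argument solves [F ^+ 2 - 2 y c = - 1]. *)
  have := quad 1 ((F ^+ 2 + 1) / (2 * c)).
  suff -> : 1 ^+ 2 * F ^+ 2 - 2 * 1 * ((F ^+ 2 + 1) / (2 * c)) * c +
      ((F ^+ 2 + 1) / (2 * c)) ^+ 2 * G ^+ 2 = -1.
    by rewrite lerNr oppr0 ler10.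
  by rewrite G0; field; rewrite gt_eqF.
have [FF|F_gt0] := leP F 0.
  have {FF F0} F0 : F = 0 by apply/eqP; rewrite eq_le FF.
  rewrite F0 mul0r leNgt; apply/negP => c0.
  have := quad ((G ^+ 2 + 1) / (2 * c)) 1.
  suff -> : ((G ^+ 2 + 1) / (2 * c)) ^+ 2 * F ^+ 2 -
      2 * ((G ^+ 2 + 1) / (2 * c)) * 1 * c + 1 ^+ 2 * G ^+ 2 = -1.
    by rewrite lerNr oppr0 ler10.
  by rewrite F0; field; rewrite gt_eqF.
have := quad G F.
have -> : G ^+ 2 * F ^+ 2 - 2 * G * F * c + F ^+ 2 * G ^+ 2 =
  2 * (F * G) * (F * G - c) by ring.
by rewrite pmulr_rge0 ?subr_ge0// !mulr_gt0.
Qed.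

Lemma seminormZ a f : D f -> nrm (a *: f) = `|a| * nrm f.
Proof.
move=> Df; rewrite /seminorm dotZl//; last exact: subspaceZ.
rewrite (sipC sip)//; last exact: subspaceZ.
by rewrite dotZl// mulrA -expr2 sqrtrM ?sqr_ge0// sqrtr_sqr.
Qed.

Lemma normr_dot_le f g : D f -> D g -> `|dot f g| <= nrm f * nrm g.
Proof.
move=> Df Dg; rewrite ler_norml dot_le_seminorm// andbT lerNl -mulN1r -dotZl//.
apply: le_trans (dot_le_seminorm (subspaceZ sD _ Df) Dg) _.
by rewrite seminormZ// normrN1 mul1r.
Qed.

(** Testing an element against itself is how bounds on inner products turn
    into bounds on norms, without dividing by a norm that may vanish. *)
Lemma seminorm_le_self f M : 0 <= M -> D f -> dot f f <= M * nrm f -> nrm f <= M.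
Proof.
move=> M0 Df; rewrite -sqr_seminorm// expr2.
have := seminorm_ge0 f; rewrite le0r => /orP[/eqP ->//|nf].
by rewrite ler_pM2r.
Qed.

Lemma ler_seminormD f g : D f -> D g -> nrm (f + g) <= nrm f + nrm g.
Proof.
move=> Df Dg; have Dfg := subspaceD sD Df Dg; apply: seminorm_le_self => //.
  by rewrite addr_ge0 ?seminorm_ge0.
by rewrite dotDl// mulrDl lerD ?dot_le_seminorm.
Qed.

Lemma seminormN f : D f -> nrm (- f) = nrm f.
Proof. by move=> Df; rewrite -scaleN1r seminormZ// normrN1 mul1r. Qed.

Lemma ler_seminormB f g : D f -> D g -> nrm (f - g) <= nrm f + nrm g.
Proof.
move=> Df Dg; rewrite -(seminormN Dg) ler_seminormD//.
by rewrite -scaleN1r; exact: subspaceZ.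
Qed.

Lemma ler_seminorm_sum n (F : 'I_n -> E) :
  (forall i, D (F i)) -> nrm (\sum_(i < n) F i) <= \sum_(i < n) nrm (F i).
Proof.
move=> DF; suff [] : D (\sum_(i < n) F i) /\
  nrm (\sum_(i < n) F i) <= \sum_(i < n) nrm (F i) by [].
elim/big_rec2: _ => [|i y x _ [Dx xy]].
  by rewrite seminorm0; split => //; exact: sD.1.
split; first exact: subspaceD.
by apply: le_trans (ler_seminormD (DF i) Dx) _; rewrite lerD2l.
Qed.

(** Scaling to the unit ball leaves out the elements of norm zero. All their
    multiples belong to the ball, so that the bound [K] holds for all the
    multiples of their images, which thus have norm zero too. *)
Lemma seminorm_le_unit_ball V (A : E -> E) K :
  subspace V -> V `<=` D -> (forall v, V v -> V (A v)) -> linear_within V A ->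
  (forall v, V v -> nrm v <= 1 -> nrm (A v) <= K) ->
  forall v, V v -> nrm (A v) <= K * nrm v.
Proof.
move=> sV VD VA lA AK v Vv.
have scaled c : 0 < c -> c * nrm v <= 1 -> c * nrm (A v) <= K.
  move=> c0 cv; have := AK _ (subspaceZ sV c Vv).
  rewrite (linear_withinZ sV lA)// !seminormZ ?gtr0_norm//; try exact: VD.
    exact.
  exact/VD/VA.
have := seminorm_ge0 v; rewrite le0r => /orP[/eqP v0|v0]; last first.
  have := scaled (nrm v)^-1; rewrite invr_gt0 mulVf ?gt_eqF// => /(_ v0 (lexx _)).
  by rewrite mulrC ler_pdivrMr.
rewrite v0 mulr0 leNgt; apply/negP => Av0.
have K0 : 0 <= K.
  have := scaled 1; rewrite v0 mulr0 ler01 ltr01 => /(_ isT isT).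
  by rewrite mul1r; apply: le_trans; exact: ltW.
have := scaled ((K + 1) / nrm (A v)); rewrite v0 mulr0 ler01 divfK ?gt_eqF//.
rewrite divr_gt0 ?ltr_wpDl// => /(_ isT isT).
by rewrite gerDl ler10.
Qed.

End Seminorm.
End SemiInnerProduct.

(** * Taylor's inequality for curves in a seminormed space *)

Section Taylor.
Context {R : realType}.

(** The polynomial with successive derivatives [c 0], [c 1], ... at [0]:
    differentiation shifts the coefficients. *)
Definition exp_poly (n : nat) (c : nat -> R) (x : R) : R :=
  \sum_(i < n) (x ^+ i / i`!%:R) * c i.

Lemma exp_poly0 n c : exp_poly n.+1 c 0 = c 0%N.
Proof.
rewrite /exp_poly big_ord_recl expr0 fact0 divr1 mul1r big1 ?addr0// => i _.
by rewrite expr0n/= mul0r mul0r.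
Qed.

Lemma is_derive_exp_poly n c (t x : R) :
  is_derive x 1 (fun y => exp_poly n.+1 c (y - t))
                (exp_poly n (c \o succn) (x - t)).
Proof.
rewrite (_ : (fun y => _) = \sum_(i < n.+1)
    (fun y => ((y - t) ^+ i / i`!%:R) * c i)); last first.
  by apply/funext => y; rewrite fct_sumE.
pose dh i : R := (i%:R * (x - t) ^+ i.-1) / i`!%:R * c i.
have -> : exp_poly n (c \o succn) (x - t) = \sum_(i < n.+1) dh i.
  rewrite big_ord_recl {1}/dh !mul0r add0r; apply: eq_bigr => i _.
  rewrite /dh /= /bump/= add1n factS natrM; field.
  by rewrite !pnatr_eq0 -!lt0n fact_gt0 nat1r pnatr_eq0.
apply: (@is_derive_sum R R R n.+1
  (fun i y => ((y - t) ^+ i / i`!%:R) * c i) x 1 dh) => i.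
have dX : is_derive x 1 (fun y : R => (y - t) ^+ i) (i%:R * (x - t) ^+ i.-1).
  have d1 : is_derive x 1 (fun y : R => y - t) 1 by apply: is_derive_eq; rewrite subr0.
  have := is_deriveX i d1; rewrite [(_ ^+ i)%R](_ : _ = fun y => (y - t) ^+ i).
    by rewrite /GRing.scale/= mulr1.
  by apply/funext => y; rewrite fctE.
rewrite (_ : (fun y => _) =
    (i`!%:R^-1 * c i) *: (fun y : R => (y - t) ^+ i)); last first.
  by apply/funext => y; rewrite scalrfctE /GRing.scale/=; ring.
by apply: is_derive_eq; rewrite /GRing.scale/= /dh; ring.
Qed.

(** The bound [M] on the last derivative enters as the last coefficient of the
    comparison polynomial. The derivative of this polynomial is then the
    comparison polynomial of the derivative of [f 0], so that an induction on
    [n] and the mean value theorem suffice. *)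
Lemma taylor_le n (f : nat -> R -> R) (a b M : R) :
  (forall i x, (i < n)%N -> x \in `]a, b[ -> is_derive x 1 (f i) (f i.+1 x)) ->
  (forall i, (i < n)%N -> {within `[a, b], continuous (f i)}) ->
  (forall x, x \in `[a, b] -> f n x <= M) ->
  forall x, x \in `[a, b] ->
    f 0%N x <= exp_poly n.+1 (fun i => if (i < n)%N then f i a else M) (x - a).
Proof.
elim: n f => [|n IH] f df cf fM x xab.
  by rewrite /exp_poly big_ord1 expr0 fact0 divr1 mul1r fM.
set c := fun i => _.
have IHx y : y \in `[a, b] -> f 1%N y <= exp_poly n.+1 (c \o succn) (y - a).
  move=> yab; apply: (IH (fun i => f i.+1)) => //.
  - by move=> i z ilt zab; apply: df.
  - by move=> i ilt; apply: cf.
have [ax|] := ltP a x; last first.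
  move=> xa; have -> : x = a by apply/eqP; rewrite eq_le xa (itvP xab).
  by rewrite subrr exp_poly0 /c.
pose G := f 0%N - (fun y => exp_poly n.+2 c (y - a)).
have dG y : y \in `]a, x[ ->
    is_derive y 1 G (f 1%N y - exp_poly n.+1 (c \o succn) (y - a)).
  move=> yax; apply: is_deriveB; last exact: is_derive_exp_poly.
  apply: df => //; move: yax xab; rewrite !in_itv/= => /andP[ay yx] /andP[_ xb].
  by rewrite ay (lt_le_trans yx).
have cG : {within `[a, x], continuous G}.
  apply: (@continuous_subspaceW _ _ _ `[a, b]).
    move=> y; rewrite /= !in_itv/= => /andP[-> yx].
    by rewrite (le_trans yx)// (itvP xab).
  move=> y; apply: cvgB; first exact: cf.
  apply: continuous_subspaceT => z.
  by apply: differentiable_continuous; apply/derivable1_diffP;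
     case: (is_derive_exp_poly n.+1 c a z).
have [z zax Gz] := MVT ax dG cG.
have : G x - G a <= 0.
  rewrite Gz mulr_le0_ge0// ?subr_ge0 ?(ltW ax)// subr_le0 IHx//.
  move: zax xab; rewrite !in_itv/= => /andP[az zx] /andP[_ xb].
  by rewrite (ltW az) (le_trans (ltW zx)).
have -> : G a = 0 by rewrite /G !fctE subrr exp_poly0 /c subrr.
by rewrite subr0 /G !fctE subr_le0.
Qed.

(** At a positive time, small increments of both signs are admissible. *)
Lemma is_derive_time_incr (f : R -> R) (t l : R) : 0 < t ->
  (h^-1 * (f (t + h) - f t)) @[h --> time_incr t] --> l ->
  is_derive t 1 f l.
Proof.
move=> t0 fl.
suff fl' : h^-1 *: ((f \o shift t) (h *: 1) - f t) @[h --> 0^'] --> l.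
  by split; [apply/cvg_ex; exists l|exact/cvg_lim].
move=> A /fl; rewrite /time_incr /nbhs/= /within/= => nA.
have th : \forall h \near 0^', 0 <= t + h.
  exists t => //= h /=; rewrite sub0r normrN => ht _.
  by rewrite -lerBlDl sub0r; have /ltW := ht; rewrite ler_norml => /andP[].
near=> h.
rewrite /= /GRing.scale/= mulr1 [h + t]addrC.
have : 0 <= t + h -> A (h^-1 * (f (t + h) - f t)) by near: h.
by apply; near: h.
Unshelve. all: end_near.
Qed.

(** At time [0] there is no two-sided derivative, but the mean value theorem
    asks for no more than one-sided continuity at the ends of the interval. *)
Lemma cvg_at_right_time_incr (f : R -> R) (t l : R) : 0 <= t ->
  (h^-1 * (f (t + h) - f t)) @[h --> time_incr t] --> l ->
  f x @[x --> t^'+] --> f t.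
Proof.
move=> t0 fl.
have right : (fun x => x - t) @ t^'+ --> time_incr t.
  move=> A [e e0 eA]; exists e => //= x /= xe tx; apply: eA => //=.
  - by rewrite sub0r normrN distrC.
  - by rewrite subr_eq0 gt_eqF.
  - by rewrite addrC subrK (le_trans t0)// ltW.
have -> : f t = 0 * l + f t by rewrite mul0r add0r.
apply: (@cvg_trans _ ((fun x => (x - t) * ((x - t)^-1 * (f (t + (x - t)) - f t)) + f t) @ t^'+)).
  apply: near_eq_cvg; near=> x.
  have tx : t < x by near: x; exact: nbhs_right_gt.
  by rewrite mulVKf ?subr_eq0 ?gt_eqF// addrC [t + _]addrC !subrK addrC subrK.
apply: cvgD; last exact: cvg_cst.
apply: cvgM; last first.
  exact: (cvg_comp (fun x => x - t) (fun h => h^-1 * (f (t + h) - f t)) right fl).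
apply: cvg_at_right_filter; rewrite -(subrr t).
by apply: cvgB; [exact: cvg_id|exact: cvg_cst].
Unshelve. all: end_near.
Qed.

End Taylor.

Section VectorTaylor.
Context {R : realType} {E : lmodType R} {D : set E} {dot : E -> E -> R}.
Context (sip : semi_inner D dot).
Local Notation nrm := (seminorm dot).

Lemma cvg_dot_quotient (w : R -> E) (w' v : E) (t : R) :
  (forall r : R, 0 <= r -> D (w r)) -> D w' -> D v -> 0 <= t ->
  nrm (h^-1 *: (w (t + h) - w t) - w') @[h --> time_incr t] --> (0 : R) ->
  (h^-1 * (dot (w (t + h)) v - dot (w t) v)) @[h --> time_incr t] --> dot w' v.
Proof.
move=> Dw Dw' Dv t0 ww'.
have sD := sip_sub sip.
have -> : dot w' v = 0 + dot w' v by rewrite add0r.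
apply: (@cvg_trans _ ((fun h => (h^-1 * (dot (w (t + h)) v - dot (w t) v) - dot w' v) + dot w' v) @ time_incr t)).
  by apply: near_eq_cvg; near=> h; rewrite subrK.
apply: cvgD; last exact: cvg_cst.
apply/norm_cvg0P.
apply: (@squeeze_cvgr _ _ _ _ (fun=> 0)
  (fun h => nrm (h^-1 *: (w (t + h) - w t) - w') * nrm v)); last 2 first.
- exact: cvg_cst.
- by rewrite -(mul0r (nrm v)); apply: cvgM => //; exact: cvg_cst.
near=> h; rewrite normr_ge0/=.
have th : 0 <= t + h by near: h; exact: withinT.
have Dth := Dw _ th; have Dt := Dw _ t0.
rewrite -(dotBl sip)// -(dotZl sip)//; last exact: subspaceB.
rewrite -(dotBl sip)//; last by apply: subspaceZ => //; exact: subspaceB.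
apply: (normr_dot_le sip) => //.
by apply: subspaceB => //; apply: subspaceZ => //; exact: subspaceB.
Unshelve. all: end_near.
Qed.

(** Testing the remainder against itself turns it into a scalar function of
    the end point, to which the scalar estimate applies. Only difference
    quotients of the curves are needed, no integration of functions with values
    in [E]. *)
Lemma seminorm_taylor n (w : nat -> R -> E) (t tau M : R) :
  (forall i (r : R), (i <= n)%N -> 0 <= r -> D (w i r)) ->
  (forall i (r : R), (i < n)%N -> 0 <= r ->
    nrm (h^-1 *: (w i (r + h) - w i r) - w i.+1 r) @[h --> time_incr r]
      --> (0 : R)) ->
  (forall r : R, 0 <= r -> nrm (w n r) <= M) ->
  0 <= t -> 0 < tau ->
  nrm (w 0%N (t + tau) - \sum_(i < n) (tau ^+ i / i`!%:R) *: w i t)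
    <= tau ^+ n / n`!%:R * M.
Proof.
move=> Dw w' wM t0 tau0; set rem := _ - _.
have sD := sip_sub sip.
have Dsum : D (\sum_(i < n) (tau ^+ i / i`!%:R) *: w i t).
  by apply: subspace_sum => // i; apply: subspaceZ => //; apply: Dw => //; exact: ltnW.
have Dtau : D (w 0%N (t + tau)) by apply: Dw => //; rewrite addr_ge0// ltW.
have Drem : D rem by exact: subspaceB.
have M0 : 0 <= M := le_trans (seminorm_ge0 _) (wM t t0).
apply: (seminorm_le_self sip) => //.
  by rewrite mulr_ge0// divr_ge0 ?exprn_ge0// ltW.
have ttau : t < t + tau by rewrite ltrDl.
pose f i r := dot (w i r) rem.
have cvf i (r : R) : (i < n)%N -> 0 <= r ->
    (h^-1 * (f i (r + h) - f i r)) @[h --> time_incr r] --> f i.+1 r.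
  move=> ilt r0; apply: cvg_dot_quotient => //; last exact: w'.
  - by move=> r' r'0; apply: Dw => //; exact: ltnW.
  - exact: Dw.
have df i (r : R) : (i < n)%N -> 0 < r -> is_derive r 1 (f i) (f i.+1 r).
  by move=> ilt r0; apply: is_derive_time_incr => //; apply: cvf => //; exact: ltW.
have cf i (r : R) : (i < n)%N -> 0 < r -> {for r, continuous (f i)}.
  move=> ilt r0; apply: differentiable_continuous; apply/derivable1_diffP.
  by case: (df i r ilt r0).
rewrite {1}/rem (dotBl sip)// (dot_suml sip)//; last first.
  by move=> i; apply: Dw => //; exact: ltnW.
rewrite lerBlDl.
have : f 0%N (t + tau) <= exp_poly n.+1
    (fun i => if (i < n)%N then f i t else M * nrm rem) (t + tau - t).
  apply: (@taylor_le R n f t (t + tau)); last by rewrite bound_itvE ltW.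
  - move=> i r ilt; rewrite in_itv/= => /andP[tr _]; apply: df => //.
    exact: le_lt_trans tr.
  - move=> i ilt; apply/continuous_within_itvP => //; split.
    + move=> r; rewrite in_itv/= => /andP[tr _]; apply: cf => //.
      exact: le_lt_trans tr.
    + exact: (cvg_at_right_time_incr t0 (cvf i t ilt t0)).
    + by apply: cvg_at_left_filter; apply: cf => //; exact: le_lt_trans ttau.
  - move=> r; rewrite in_itv/= => /andP[tr _].
    have r0 := le_trans t0 tr.
    apply: le_trans (dot_le_seminorm sip _ Drem) _; first exact: Dw.
    by rewrite ler_wpM2r ?seminorm_ge0// wM.
rewrite addrAC subrr add0r /exp_poly big_ord_recr/= ltnn mulrA.
by under eq_bigr => i _ do rewrite ltn_ord.
Qed.

End VectorTaylor.

(** * One step of a Runge-Kutta scheme *)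

Section RungeKutta.
Context {R : realType} {E : lmodType R} {D V : set E} {dot : E -> E -> R}.
Context (sip : semi_inner D dot) (sV : subspace V) (VD : V `<=` D).
Context (B : E -> E) (VB : forall v, V v -> V (B v)) (lB : linear_within V B).
Local Notation nrm := (seminorm dot).

Lemma iter_stable i v : V v -> V (iter i B v).
Proof. by move=> Vv; elim: i => //= i; exact: VB. Qed.

Lemma linear_within_iter i : linear_within V (iter i B).
Proof.
by move=> a v w Vv Vw; elim: i => //= i ->; rewrite lB//; exact: iter_stable.
Qed.

Definition poly_op (s : nat) (alpha : nat -> R) (v : E) : E :=
  \sum_(i < s.+1) alpha i *: iter i B v.

Lemma poly_op_stable s alpha v : V v -> V (poly_op s alpha v).
Proof.
by move=> Vv; apply: subspace_sum => // i; apply: subspaceZ => //; exact: iter_stable.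
Qed.

Lemma linear_within_poly_op s alpha : linear_within V (poly_op s alpha).
Proof.
move=> a v w Vv Vw; rewrite /poly_op scaler_sumr -big_split/=.
apply: eq_bigr => i _; rewrite linear_within_iter//.
by rewrite scalerDr !scalerA mulrC.
Qed.

Hypothesis (B1 : forall v, V v -> nrm (B v) <= nrm v).

Lemma seminorm_iter_le i j v : (i <= j)%N -> V v ->
  nrm (iter j B v) <= nrm (iter i B v).
Proof.
move=> /subnK <- Vv; elim: (j - i)%N => //= k; apply: le_trans.
exact/B1/iter_stable.
Qed.

Context (p : nat) (w : nat -> E) (e : nat -> R).
Hypothesis (Vw : forall i, (i <= p.+1)%N -> V (w i)).
Hypothesis (we : forall i, (i <= p)%N -> nrm (w i.+1 - B (w i)) <= e i.+1).

Let S := \sum_(1 <= i < p.+2) e i.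

Let e_ge0 i : (i <= p)%N -> 0 <= e i.+1.
Proof. by move=> ip; apply: le_trans (we ip); exact: seminorm_ge0. Qed.

(** The defect [w i - B^i (w 0)] telescopes into the sum of the
    [B^(i - k - 1) (w k.+1 - B (w k))] for [k < i], and [B] is a contraction. *)
Lemma seminorm_defect_le i : (i <= p.+1)%N -> nrm (w i - iter i B (w 0%N)) <= S.
Proof.
move=> ip; suff defect : nrm (w i - iter i B (w 0%N)) <= \sum_(1 <= k < i.+1) e k.
  apply: le_trans defect _; rewrite /S.
  rewrite (@big_cat_nat _ _ _ i.+1 1 p.+2)//= lerDl.
  rewrite big_nat; apply: sumr_ge0 => -[|k] /andP[ik kp] //.
  exact: e_ge0.
elim: i ip => [|i IH] ip.
  by rewrite big_geq// subrr (seminorm0 sip).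
have Vi := Vw (ltnW ip); have Vi1 := Vw ip.
have V0 := Vw (leq0n _); have Vit := iter_stable i V0.
have -> : w i.+1 - iter i.+1 B (w 0%N) =
    (w i.+1 - B (w i)) + B (w i - iter i B (w 0%N)).
  by rewrite (linear_withinB lB)//= addrA subrK.
have V1 : V (w i.+1 - B (w i)) by apply: subspaceB => //; exact: VB.
have V2 : V (w i - iter i B (w 0%N)) by exact: subspaceB.
apply: le_trans (ler_seminormD sip (VD V1) (VD (VB V2))) _.
rewrite big_nat_recr//= addrC lerD ?we//.
by apply: le_trans (B1 V2) _; apply: IH; exact: ltnW.
Qed.

(** Up to order [p], the coefficients of the scheme are those of the Taylor
    polynomial, whose terms [B^i w 0] replaces at the cost of a defect; the
    remaining terms are no larger than [B^(p+1) w 0], since [B] is a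
    contraction. As [alpha 0 = 1], the Taylor remainder itself is absorbed
    by the term of index [0], which has no defect. *)
Lemma local_error_le s alpha (w' : E) Y : RK_order s alpha p -> V w' ->
  nrm (w' - \sum_(i < p.+1) (i`!%:R)^-1 *: w i) <= Y ->
  nrm (w p.+1) <= Y -> S <= Y ->
  nrm (w' - poly_op s alpha (w 0%N)) <= 2 * (\sum_(i < s.+1) `|alpha i|) * Y.
Proof.
move=> [alpha_s alpha_p _] Vw' taylor wp SY.
have Y0 : 0 <= Y by apply: le_trans (seminorm_ge0 _) wp.
have V0 := Vw (leq0n _).
have ps : (p <= s)%N.
  rewrite leqNgt; apply/negP => /alpha_s; rewrite alpha_p// => /eqP.
  by rewrite invr_eq0 pnatr_eq0 gtn_eqF ?fact_gt0.
(* The defect of the term of index [i], that term being absent from the Taylor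
   sum when [i > p]. *)
pose c i := (if (i <= p)%N then w i else 0) - iter i B (w 0%N).
have Vc i : V (c i).
  apply: subspaceB => //; last exact: iter_stable.
  case: ifP => ip; last exact: sV.1.
  by apply: Vw; exact: leqW.
have -> : w' - poly_op s alpha (w 0%N) =
    (w' - \sum_(i < p.+1) (i`!%:R)^-1 *: w i) + \sum_(i < s.+1) alpha i *: c i.
  suff -> : \sum_(i < s.+1) alpha i *: c i =
      \sum_(i < p.+1) (i`!%:R)^-1 *: w i - poly_op s alpha (w 0%N).
    by rewrite addrA subrK.
  rewrite (big_ord_widen s.+1 (fun i => (i`!%:R)^-1 *: w i))// [in RHS]big_mkcond/=.
  rewrite /poly_op -sumrB; apply: eq_bigr => i _.
  rewrite scalerBr ltnS; congr (_ - _).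
  by case: ifP => ip; rewrite ?scaler0// alpha_p.
have Vt : V (w' - \sum_(i < p.+1) (i`!%:R)^-1 *: w i).
  apply: subspaceB => //; apply: subspace_sum => // i; apply: subspaceZ => //.
  by apply: Vw; exact: leqW (ltn_ord i).
have Vs : V (\sum_(i < s.+1) alpha i *: c i).
  by apply: subspace_sum => // i; exact: subspaceZ.
apply: le_trans (ler_seminormD sip (VD Vt) (VD Vs)) _.
have cY i : nrm (alpha i *: c i) <= `|alpha i| * (2 * Y).
  rewrite (seminormZ sip); last exact: VD.
  rewrite ler_wpM2l// /c; case: leqP => ip.
    apply: le_trans (seminorm_defect_le (leqW ip)) _.
    by rewrite (le_trans SY)// mulr2n mulrDl mul1r lerDl.
  rewrite sub0r (seminormN sip); last exact/VD/iter_stable.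
  apply: le_trans (seminorm_iter_le ip V0) _.
  have Vp := Vw (leqnn _); have Vip := iter_stable p.+1 V0.
  rewrite -[iter _ _ _](subKr (w p.+1)).
  apply: le_trans (ler_seminormB sip (VD Vp) (VD (subspaceB sV Vp Vip))) _.
  rewrite mulr2n mulrDl mul1r lerD//.
  exact: le_trans (seminorm_defect_le (leqnn _)) SY.
have c0 : c 0%N = 0 by rewrite /c/= subrr.
have alpha0 : alpha 0%N = 1 by rewrite alpha_p// fact0 invr1.
have sumY : nrm (\sum_(i < s.+1) alpha i *: c i) <=
    \sum_(i < s) `|alpha i.+1| * (2 * Y).
  rewrite big_ord_recl/= c0 scaler0 add0r.
  apply: le_trans (ler_seminorm_sum sip (fun i => VD (subspaceZ sV _ (Vc _)))) _.
  by apply: ler_sum => i _; exact: cY.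
apply: le_trans (lerD taylor sumY) _.
rewrite -mulr_suml big_ord_recl/= alpha0 normr1.
under [X in _ <= 2 * (1 + X) * Y]eq_bigr => i _ do rewrite /bump/= add1n.
set X := \sum_(i < s) _; lra.
Qed.

End RungeKutta.

(** * Discrete Gronwall inequality *)

Section Gronwall.
Context {R : realType} (mu : R) (mu0 : 0 <= mu).

Lemma sigma0 : sigma mu 0 = 0.
Proof. by rewrite /sigma; case: ifP => // _; rewrite mulr0 expR0 subrr mul0r. Qed.

Lemma sigma_gt0 (t : R) : 0 < t -> 0 < sigma mu t.
Proof.
move=> t0; rewrite /sigma; case: ifPn => // mu_neq0.
have mu_gt0 : 0 < mu by rewrite lt_neqAle eq_sym mu_neq0.
by rewrite divr_gt0// subr_gt0 expR_gt1 mulr_gt0.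
Qed.

(** [sigma mu] solves [y' = mu y + 1], [y 0 = 0], a solution of which is convex and
    hence lies above one step of the explicit Euler method. *)
Lemma sigma_step (t tau : R) :
  (1 + mu * tau) * sigma mu t + tau <= sigma mu (t + tau).
Proof.
rewrite /sigma; case: ifPn => [/eqP ->|mu_neq0]; first by rewrite mul0r addr0 mul1r.
have mu_gt0 : 0 < mu by rewrite lt_neqAle eq_sym mu_neq0.
rewrite ler_pdivlMr// mulrDl.
have -> : (1 + mu * tau) * ((expR (mu * t) - 1) / mu) * mu + tau * mu =
    (1 + mu * tau) * expR (mu * t) - 1 by field.
by rewrite lerB// mulrDr expRD mulrC ler_wpM2l ?expR_ge0// expR_ge1Dx.
Qed.

Lemma discrete_gronwall (x : nat -> R) (tau K : R) : 0 <= tau -> 0 <= K ->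
  (forall n, 0 <= x n) ->
  (forall n, x n.+1 <= (1 + mu * tau) * x n + tau * K) ->
  forall n, x n <= expR (mu * (n%:R * tau)) * x 0%N + K * sigma mu (n%:R * tau).
Proof.
move=> tau0 K0 x0 xS; elim=> [|n IH].
  by rewrite mul0r mulr0 expR0 mul1r sigma0 mulr0 addr0.
have mt0 : 0 <= 1 + mu * tau by rewrite addr_ge0// mulr_ge0.
apply: le_trans (xS n) _.
have -> : n.+1%:R * tau = n%:R * tau + tau by rewrite -addn1 natrD mulrDl mul1r.
set t := n%:R * tau in IH *.
apply: le_trans (_ : (1 + mu * tau) * (expR (mu * t) * x 0%N + K * sigma mu t) + tau * K <= _).
  by rewrite lerD2r ler_wpM2l.
have -> : (1 + mu * tau) * (expR (mu * t) * x 0%N + K * sigma mu t) + tau * K =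
  (expR (mu * t) * (1 + mu * tau)) * x 0%N + K * ((1 + mu * tau) * sigma mu t + tau).
  by ring.
apply: lerD; last by rewrite ler_wpM2l// sigma_step.
by rewrite ler_wpM2r// [mu * (t + _)]mulrDr expRD ler_wpM2l ?expR_ge0// expR_ge1Dx.
Qed.

End Gronwall.

(** * The semi-inner product of L2 *)

Section OpenMeasurable.
Context {R : realType} {d : nat}.

Definition rat_box (z : 'rV[rat]_d * 'rV[rat]_d) : set 'rV[R]_d :=
  [set x | forall i, x 0 i \in `]ratr (z.1 0 i), ratr (z.2 0 i)[ ].

Lemma measurable_rat_box z : measurable (rat_box z).
Proof.
rewrite (_ : rat_box z = \bigcap_(i in [set: 'I_d])
    ([set: 'rV[R]_d] `&` (fun x => x 0 i : measurableTypeR R) @^-1`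
       [set` `]ratr (z.1 0 i), ratr (z.2 0 i)[])).
  apply: fin_bigcap_measurable => // i _.
  by apply: measurable_rV_coord => //; exact: measurable_itv.
by apply/seteqP; split=> x zx i; [split => //; exact: zx|have [] := zx i I].
Qed.

(** The sigma-algebra is generated by the coordinates, while open sets are
    those of the max norm: an open set is the union of the countably many boxes
    with rational ends that it contains. *)
Lemma open_rV_measurable (Omega : set 'rV[R]_d) : open Omega -> measurable Omega.
Proof.
move=> oO.
rewrite (_ : Omega = \bigcup_z
    (if pselect (rat_box z `<=` Omega) then rat_box z else set0)); last first.
  apply/seteqP; split=> [x Ox|x [z _]]; last first.
    by case: pselect => // zO; exact: zO.
  have /nbhs_ballP[e /= e0 eO] : nbhs x Omega by exact: open_nbhs_nbhs.
  have rat_below i : exists q : rat, ratr q \in `]x 0 i - e, x 0 i[.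
    by apply: rat_in_itvoo; rewrite ltrBlDr ltrDl.
  have rat_above i : exists q : rat, ratr q \in `]x 0 i, x 0 i + e[.
    by apply: rat_in_itvoo; rewrite ltrDl.
  have [lo xlo] := choice rat_below; have [up xup] := choice rat_above.
  exists (\row_i lo i, \row_i up i) => //.
  case: pselect => [_ i|]; last first.
    case=> y ybox; apply: eO; split => // i j; rewrite ord1.
    have := ybox j; have := xlo j; have := xup j.
    rewrite !mxE !in_itv/= => /andP[_ ?] /andP[? _] /andP[? ?].
    by rewrite /ball/= ltr_distlC; apply/andP; split; lra.
  by have := xlo i; have := xup i; rewrite !mxE !in_itv/= => /andP[-> _] /andP[_ ->].
apply: countable_bigcupT_measurable; first exact: countableP.
by move=> z; case: pselect => zO; [exact: measurable_rat_box|exact: measurable0].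
Qed.

End OpenMeasurable.

Section L2.
Context {R : realType} {d m : nat} (Omega : set 'rV[R]_d).
Hypothesis mOmega : measurable Omega.
Implicit Types f g h : 'rV[R]_d -> 'cV[R]_m.
Let mu := @rV_lebesgue R d.

Lemma integrable_sum_sqr f : in_L2 Omega f ->
  mu.-integrable Omega (EFin \o (fun x => \sum_j f x j 0 ^+ 2)).
Proof.
move=> [mf foo]; apply/integrableP; split.
  apply/measurable_realfun.measurable_EFinP; apply: measurable_sum => j.
  exact: measurable_realfun.measurable_funX.
rewrite (eq_integral (fun x => (\sum_j f x j 0 ^+ 2)%:E))// => x _ /=.
by rewrite ger0_norm// sumr_ge0// => j _; exact: sqr_ge0.
Qed.

(** Young's inequality: [|a b| <= a^2 + b^2]. *)
Lemma integrable_dotL2 f g : in_L2 Omega f -> in_L2 Omega g ->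
  mu.-integrable Omega (EFin \o (fun x => \sum_j f x j 0 * g x j 0)).
Proof.
move=> fL gL.
have := integrableD mOmega (integrable_sum_sqr fL) (integrable_sum_sqr gL).
apply: le_integrable => //.
  apply/measurable_realfun.measurable_EFinP; apply: measurable_sum => j.
  by apply: measurable_realfun.measurable_funM; [apply fL.1|apply gL.1].
move=> x _; rewrite /= lee_fin -big_split/=.
apply: le_trans (ler_norm_sum _ _ _) _.
apply: le_trans (ler_norm _); apply: ler_sum => j _; rewrite normrM.
rewrite -[f x j 0 ^+ 2]real_normK ?num_real// -[g x j 0 ^+ 2]real_normK ?num_real//.
by have := sqr_ge0 (`|f x j 0| - `|g x j 0|); have := normr_ge0 (f x j 0);
  have := normr_ge0 (g x j 0); nra.
Qed.

Lemma in_L2P f : in_L2 Omega f <->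
  (forall j, measurable_fun Omega (fun x => f x j 0)) /\
  mu.-integrable Omega (EFin \o (fun x => \sum_j f x j 0 ^+ 2)).
Proof.
split=> [fL|[mf /integrableP[_ fi]]]; first by split; [exact: fL.1|exact: integrable_sum_sqr].
split => //; rewrite (eq_integral (fun x => `|(\sum_j f x j 0 ^+ 2)%:E|%E))// => x _ /=.
by rewrite ger0_norm// sumr_ge0// => j _; exact: sqr_ge0.
Qed.

Lemma subspace_L2 : subspace (in_L2 Omega : set ('rV[R]_d -> 'cV[R]_m)).
Proof.
split.
  split.
    move=> j; rewrite (_ : (fun _ => _) = cst 0); first exact: measurable_cst.
    by apply/funext => x; rewrite mxE.
  rewrite (eq_integral (cst 0%E)) ?integral0 ?ltry// => x _.
  by rewrite big1// => j _; rewrite mxE expr0n.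
move=> a f g fL gL; apply/in_L2P; split.
  move=> j; rewrite (_ : (fun _ => _) = (fun x => a * f x j 0 + g x j 0)); last first.
    by apply/funext => x; rewrite !mxE.
  apply: measurable_realfun.measurable_funD; last exact: gL.1.
  by apply: measurable_realfun.measurable_funM; [exact: measurable_cst|exact: fL.1].
rewrite (_ : EFin \o _ =
  ((fun x => (a ^+ 2)%:E * (\sum_j f x j 0 ^+ 2)%R%:E) \+
  ((fun x => (2 * a)%:E * (\sum_j f x j 0 * g x j 0)%R%:E) \+
  (fun x => (\sum_j g x j 0 ^+ 2)%R%:E)))%E); last first.
  apply/funext => x /=; rewrite -!EFinM -!EFinD; congr EFin.
  rewrite !mulr_sumr -!big_split/=; apply: eq_bigr => j _; rewrite !mxE; ring.
apply: integrableD => //; first by apply: integrableZl => //; exact: integrable_sum_sqr.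
apply: integrableD => //; last exact: integrable_sum_sqr.
by apply: integrableZl => //; exact: integrable_dotL2.
Qed.

Lemma semi_inner_L2 : semi_inner (in_L2 Omega) (@dotL2 R d m Omega).
Proof.
split; first exact: subspace_L2.
- move=> f g _ _; apply: eq_Rintegral => x _.
  by apply: eq_bigr => j _; rewrite mulrC.
- move=> a f g h fL gL hL; rewrite /dotL2.
  rewrite -RintegralZl//; last exact: integrable_dotL2.
  rewrite -RintegralD//; last 2 first.
  + rewrite (_ : EFin \o _ = (fun x => a%:E * (\sum_j f x j 0 * h x j 0)%R%:E)%E)//.
    by apply: integrableZl => //; exact: integrable_dotL2.
  + exact: integrable_dotL2.
  apply: eq_Rintegral => x _; rewrite mulr_sumr -big_split/=.
  by apply: eq_bigr => j _; rewrite !mxE; ring.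
- move=> f _; apply: Rintegral_ge0 => x _; apply: sumr_ge0 => j _.
  by rewrite -expr2 sqr_ge0.
Qed.

End L2.

(** * Consistency of the fully discrete scheme *)

Section Scheme.
Context {R : realType} {d m : nat} (Omega : set 'rV[R]_d).
Implicit Types (f g v : 'rV[R]_d -> 'cV[R]_m).

Lemma eq_normL2 f g : {in Omega, f =1 g} -> normL2 Omega f = normL2 Omega g.
Proof.
move=> fg; congr Num.sqrt; apply: eq_Rintegral => x Ox.
by apply: eq_bigr => j _; rewrite fg.
Qed.

Lemma fin_dim_subspaceP (Vh : set ('rV[R]_d -> 'cV[R]_m)) :
  fin_dim_subspace Vh -> subspace Vh.
Proof.
move=> [N [phi ->]]; split.
  by exists (fun=> 0); rewrite big1// => i _; rewrite scale0r.
move=> a _ _ [b ->] [c ->]; exists (fun i => a * b i + c i).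
rewrite scaler_sumr -big_split/=; apply: eq_bigr => i _.
by rewrite scalerDl scalerA.
Qed.

Lemma normL2_le_opnorm (Vh : set ('rV[R]_d -> 'cV[R]_m)) A (K : R) :
  measurable Omega -> subspace Vh -> Vh `<=` in_L2 Omega ->
  (forall v, Vh v -> Vh (A v)) -> linear_on Vh A ->
  (opnorm Omega Vh A <= K%:E)%E ->
  forall v, Vh v -> normL2 Omega (A v) <= K * normL2 Omega v.
Proof.
move=> mO sV VL2 VA lA AK.
apply: (seminorm_le_unit_ball (semi_inner_L2 mO) sV VL2 VA lA) => v Vv v1.
rewrite -lee_fin; apply: le_trans AK; apply: ereal_sup_ubound.
by exists v.
Qed.

Context (L Lh Pi : ('rV[R]_d -> 'cV[R]_m) -> 'rV[R]_d -> 'cV[R]_m).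
Context (q p : nat) (u : R -> 'rV[R]_d -> 'cV[R]_m).
Context (Vh Dom : set ('rV[R]_d -> 'cV[R]_m)) (ET ES : nat -> R -> R).
Context (mO : measurable Omega) (sV : subspace Vh) (VL2 : Vh `<=` in_L2 Omega)
  (VLh : forall v, Vh v -> Vh (Lh v)) (lLh : linear_on Vh Lh)
  (std : smooth_to_discrete Omega Dom Vh Pi)
  (reg : regular Omega q L Dom Pi p u)
  (spc : space_consistent Omega L Vh Lh Pi p u ET ES).
Let sip := semi_inner_L2 mO : semi_inner (in_L2 Omega) (@dotL2 R d m Omega).

Lemma regular_dtE i t : (i <= p.+1)%N -> 0 <= t ->
  {in Omega, iter i dt u t =1 iter i L (u t)}.
Proof.
by case: i => // i ip t0 x /set_mem Ox; apply: (reg_dtL reg).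
Qed.

Lemma regular_PiE i t : (i <= p.+1)%N -> 0 <= t ->
  Pi (iter i dt u t) = Pi (iter i L (u t)).
Proof.
move=> ip t0; apply/esym.
exact: (std_restr std (reg_dom reg ip t0) (regular_dtE ip t0)).2.
Qed.

Lemma Pi_stable i t : (i <= p.+1)%N -> 0 <= t -> Vh (Pi (iter i dt u t)).
Proof. by move=> ip t0; apply: (std_range std); exact: (reg_dom reg). Qed.

(** The residual lies in the discrete space, so that it is an admissible test
    function against itself. *)
Lemma space_residual_le i t : (i <= p)%N -> 0 <= t ->
  normL2 Omega (Pi (iter i.+1 dt u t) - Lh (Pi (iter i dt u t)))
    <= ES i.+1 t + ET i.+1 t.
Proof.
move=> ip t0.
have Vi := Pi_stable (leqW ip) t0; have Vi1 := @Pi_stable i.+1 t ip t0.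
have Vr : Vh (Pi (iter i.+1 dt u t) - Lh (Pi (iter i dt u t))).
  by apply: subspaceB => //; exact: VLh.
have ET0 : 0 <= ET i.+1 t.
  by apply: le_trans (@spc_T _ _ _ _ _ _ _ _ _ _ _ _ spc i.+1 t ip t0); exact: sqrtr_ge0.
have ES0 : 0 <= ES i.+1 t by apply: (spc_S_ge0 spc).
apply: (seminorm_le_self sip); [exact: addr_ge0|exact: VL2|].
have L2r := VL2 Vr; move: (Vr) L2r.
rewrite (regular_PiE (leqW ip) t0) (@regular_PiE i.+1 t ip t0).
rewrite (regular_PiE (leqW ip) t0) (@regular_PiE i.+1 t ip t0) in Vi Vi1.
set r := _ - _ => V_r L2r.
have UL2 : in_L2 Omega (iter i.+1 L (u t)) by apply: (reg_L2 reg).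
have L2d : in_L2 Omega (iter i.+1 L (u t) - Pi (iter i.+1 L (u t))).
  by apply: (subspaceB (sip_sub sip)) => //; exact: VL2.
have L2e : in_L2 Omega (iter i.+1 L (u t) - Lh (Pi (iter i L (u t)))).
  by apply: (subspaceB (sip_sub sip)) => //; apply: VL2; exact: VLh.
have -> : dotL2 Omega r r =
    dotL2 Omega (iter i.+1 L (u t) - Lh (Pi (iter i L (u t)))) r -
    dotL2 Omega (iter i.+1 L (u t) - Pi (iter i.+1 L (u t))) r.
  by rewrite -(dotBl sip)//; congr dotL2; rewrite opprB addrC subrKA.
rewrite mulrDl; apply: lerD.
  apply: le_trans (ler_norm _) _.
  exact: (@spc_S _ _ _ _ _ _ _ _ _ _ _ _ spc i.+1 t).
apply: le_trans (ler_norm _) _; rewrite normrN.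
apply: le_trans (normr_dot_le sip L2d L2r) _.
by rewrite ler_wpM2r ?sqrtr_ge0//; apply: (spc_T spc).
Qed.

Lemma normL2_Pi_le t : 0 <= t ->
  normL2 Omega (Pi (iter p.+1 dt u t)) <=
  normL2 Omega (iter p.+1 dt u t) + ET p.+1 t.
Proof.
move=> t0; rewrite (eq_normL2 (regular_dtE (leqnn _) t0)).
have VPi := Pi_stable (leqnn p.+1) t0.
rewrite (regular_PiE (leqnn _) t0) in VPi *.
have UL2 := reg_L2 reg (leqnn p.+1) t0.
rewrite -{1}[Pi _](subKr (iter p.+1 L (u t))).
apply: le_trans (ler_seminormB sip UL2 _) _.
  by apply: (subspaceB (sip_sub sip)) => //; exact: VL2.
by rewrite lerD2l; apply: (spc_T spc).
Qed.

Context (s : nat) (alpha : nat -> R) (lambda mu tau : R) (e : nat -> R) (D : R).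
Context (RK : RK_order s alpha p) (tau01 : 0 < tau <= 1)
  (lambda1 : lambda < 1)
  (CFL : (tau%:E * opnorm Omega Vh Lh <= lambda%:E)%E)
  (eE : forall i t, (0 < i <= p.+1)%N -> 0 <= t -> ES i t + ET i t <= e i)
  (DE : forall t, 0 <= t -> normL2 Omega (iter p.+1 dt u t) <= D).

(** This is the time step constraint, as [lambda < 1]. *)
Lemma scaled_Lh_contraction v : Vh v ->
  normL2 Omega (tau *: Lh v) <= normL2 Omega v.
Proof.
have /andP[tau0 _] := tau01.
rewrite -[leRHS]mul1r; move: v.
apply: (@normL2_le_opnorm Vh (fun v => tau *: Lh v)) => //.
- by move=> v Vv; apply: subspaceZ => //; exact: VLh.
- by move=> b v w Vv Vw; rewrite lLh// scalerDr !scalerA mulrC.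
apply: ub_ereal_sup => _ [v [Vv v1] <-]; rewrite lee_fin.
rewrite [normL2 _ _](seminormZ sip); last exact/VL2/VLh.
have lambda_le1 : (lambda%:E <= 1%:E)%E by rewrite lee_fin ltW.
rewrite gtr0_norm// -lee_fin; apply: le_trans (le_trans CFL lambda_le1).
rewrite EFinM lee_pmul2l//.
by apply: ereal_sup_ubound; exists v.
Qed.

(** [e i] and [D] are finite bounds for the consistency error of order [i] and
    for the last time derivative. The image of the latter under [Pi] has norm at
    most [D + e p.+1], and the sum already contains [e p.+1]. *)
Lemma truncation_error_le t : 0 <= t ->
  normL2 Omega (Pi (u (t + tau)) - RK_step s alpha tau Lh (Pi (u t))) <=
  2 * (\sum_(i < s.+1) `|alpha i|) *
    (\sum_(1 <= i < p.+2) tau ^+ i * e i + tau ^+ p.+1 * D).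
Proof.
move=> t0; have /andP[tau0 tau1] := tau01.
have tau_ge0 := ltW tau0.
have ET0 i r : (i <= p.+1)%N -> 0 <= r -> 0 <= ET i r.
  by move=> ip r0; apply: le_trans (spc_T spc ip r0); exact: sqrtr_ge0.
have e0 i : (0 < i <= p.+1)%N -> 0 <= e i.
  move=> ip; apply: le_trans (eE ip (lexx 0)).
  rewrite addr_ge0//; first exact: (spc_S_ge0 spc).
  by apply: ET0 => //; case/andP: ip.
have ETe r : 0 <= r -> ET p.+1 r <= e p.+1.
  have p1 : (0 < p.+1 <= p.+1)%N by rewrite /=.
  by move=> r0; apply: le_trans (eE p1 r0); rewrite lerDr (spc_S_ge0 spc).
have D0 : 0 <= D by apply: le_trans (DE t0); exact: sqrtr_ge0.
set S := \sum_(1 <= i < p.+2) _; set Y := S + _.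
have Pi_Y r : 0 <= r -> tau ^+ p.+1 * normL2 Omega (Pi (iter p.+1 dt u r)) <= Y.
  move=> r0; apply: le_trans (_ : tau ^+ p.+1 * (D + e p.+1) <= _).
    rewrite ler_wpM2l ?exprn_ge0//; apply: le_trans (normL2_Pi_le r0) _.
    by rewrite lerD ?DE// ETe.
  rewrite /Y /S big_nat_recr//= mulrDr [leRHS]addrC lerD2l lerDr.
  rewrite big_nat; apply: sumr_ge0 => i /andP[i0 ip].
  by rewrite mulr_ge0 ?exprn_ge0// e0// i0 ltnW.
have SY : S <= Y by rewrite /Y lerDl mulr_ge0// exprn_ge0.
pose w i := tau ^+ i *: Pi (iter i dt u t).
have -> : Pi (u t) = w 0%N by rewrite /w expr0 scale1r.
have Vw i : (i <= p.+1)%N -> Vh (w i).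
  by move=> ip; apply: subspaceZ => //; exact: Pi_stable.
apply: (@local_error_le _ _ _ _ _ sip sV VL2 (fun v => tau *: Lh v) _ _
  _ p w (fun i => tau ^+ i * e i)) => //.
- by move=> v Vv; apply: subspaceZ => //; exact: VLh.
- by move=> b v v' Vv Vv'; rewrite lLh// scalerDr !scalerA mulrC.
- exact: scaled_Lh_contraction.
- move=> i ip; rewrite /w.
  rewrite (linear_withinZ sV lLh); last by apply: Pi_stable => //; exact: leqW.
  rewrite scalerA -exprS -scalerBr (seminormZ sip); last first.
    apply: (subspaceB (sip_sub sip)); apply: VL2; first exact: Pi_stable.
    by apply: VLh; apply: Pi_stable => //; exact: leqW.
  rewrite ger0_norm ?exprn_ge0// ler_wpM2l ?exprn_ge0//.
  by apply: le_trans (space_residual_le ip t0) _; exact: eE.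
- by apply: (@Pi_stable 0 (t + tau)) => //; rewrite addr_ge0.
(* The factor [tau ^- p.+1] in the bound on the last derivative cancels the
   power of [tau] of the Taylor remainder; its [1 / (p+1)!] is at most [1]. *)
- have := @seminorm_taylor _ _ _ _ sip p.+1 (fun i r => Pi (iter i dt u r)) t tau.
  move=> /(_ (tau ^- p.+1 * Y)) taylor.
  under eq_bigr => i _ do rewrite /w scalerA mulrC.
  apply: le_trans (taylor _ _ _ t0 tau0) _.
  + by move=> i r ip r0; apply: VL2; exact: Pi_stable.
  + by move=> i r ip r0; exact: (reg_Pi_dt reg).
  + by move=> r r0; rewrite mulrC ler_pdivlMr ?exprn_gt0// mulrC Pi_Y.
  rewrite mulrAC mulrA divff ?mul1r ?expf_neq0 ?gt_eqF//.
  have Y0 : 0 <= Y by apply: le_trans (Pi_Y _ t0); rewrite mulr_ge0 ?exprn_ge0 ?sqrtr_ge0.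
  by rewrite ler_pdivrMr ?ltr0n ?fact_gt0// ler_peMr// ler1n fact_gt0.
- rewrite /w (seminormZ sip); last by apply: VL2; exact: Pi_stable.
  by rewrite ger0_norm ?exprn_ge0// Pi_Y.
Qed.

End Scheme.

(** * The error estimate *)

Theorem theorem3p2 (R : realType) (d m : nat) (Omega : set 'rV[R]_d)
  (q : nat) (a : {ffun 'I_d -> 'I_q.+1} -> 'rV[R]_d -> 'M[R]_m)
  (u : R -> 'rV[R]_d -> 'cV[R]_m)
  (Vh : set ('rV[R]_d -> 'cV[R]_m))
  (Lh : ('rV[R]_d -> 'cV[R]_m) -> 'rV[R]_d -> 'cV[R]_m)
  (Dom : set ('rV[R]_d -> 'cV[R]_m))
  (Pi : ('rV[R]_d -> 'cV[R]_m) -> 'rV[R]_d -> 'cV[R]_m)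
  (s p : nat) (alpha : nat -> R) (ET ES : nat -> R -> R)
  (lambda mu tau : R) (uh : nat -> 'rV[R]_d -> 'cV[R]_m) :
  open Omega ->
  fin_dim_subspace Vh -> Vh `<=` in_L2 Omega ->
  (forall v, Vh v -> Vh (Lh v)) -> linear_on Vh Lh ->
  smooth_to_discrete Omega Dom Vh Pi ->
  exact_solution Omega (diffop a) u ->
  regular Omega q (diffop a) Dom Pi p u ->
  lambda < 1 ->
  fully_discrete_stable Omega Vh Lh s alpha lambda mu ->
  (1 <= p)%N -> RK_order s alpha p ->
  space_consistent Omega (diffop a) Vh Lh Pi p u ET ES ->
  0 < tau <= 1 -> (tau%:E * opnorm Omega Vh Lh <= lambda%:E)%E ->
  Vh (uh 0%N) -> (forall n, uh n.+1 = RK_step s alpha tau Lh (uh n)) ->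
  let E := space_error ET ES in
  let Cstar := 2 * \sum_(i < s.+1) `|alpha i| in
  forall n : nat, let tn := n%:R * tau in
  ((normL2 Omega (u tn - uh n))%:E <=
     (expR (mu * tn) * normL2 Omega (Pi (u 0) - uh 0%N))%:E + E 0%N +
     (Cstar * sigma mu tn)%:E *
       (\sum_(1 <= i < p.+2) (tau ^+ i.-1)%:E * E i +
        sup_time (fun t => normL2 Omega (iter p.+1 dt u t)) * (tau ^+ p)%:E))%E.
Proof.
move=> oO fdV VL2 VLh lLh std _ reg lambda1 [mu0 FS] _ RK spc tau01 CFL V0 uhS.
move=> E Cstar n; cbv zeta; set tn := n%:R * tau.
have mO := open_rV_measurable oO; have sV := fin_dim_subspaceP fdV.
pose sip := semi_inner_L2 mO : semi_inner (in_L2 Omega) (@dotL2 R d m Omega).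
have /andP[tau0 tau1] := tau01; have tau_ge0 := ltW tau0.
have t_ge0 k : 0 <= k%:R * tau by rewrite mulr_ge0.
have lB : linear_within Vh (fun w => tau *: Lh w).
  by move=> b v w Vv Vw; rewrite lLh// scalerDr !scalerA mulrC.
have VB v : Vh v -> Vh (tau *: Lh v).
  by move=> Vv; apply: subspaceZ => //; exact: VLh.
have VRK v : Vh v -> Vh (RK_step s alpha tau Lh v).
  exact: (poly_op_stable sV VB s alpha).
have lRK : linear_on Vh (RK_step s alpha tau Lh).
  exact: (linear_within_poly_op VB lB s alpha).
have Vuh k : Vh (uh k) by elim: k => // k IH; rewrite uhS; exact: VRK.
have VPi t : 0 <= t -> Vh (Pi (u t)) by exact: (Pi_stable std reg (leq0n p.+1)).
have ET0 i t : (i <= p.+1)%N -> 0 <= t -> 0 <= ET i t.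
  by move=> ip t0; apply: le_trans (spc_T spc ip t0); exact: sqrtr_ge0.
have uE t : 0 <= t -> ((ET 0%N t)%:E <= E 0%N)%E.
  by move=> t0; apply: ereal_sup_ubound; exists t.
have iE i t : (0 < i)%N -> 0 <= t -> ((ES i t + ET i t)%:E <= E i)%E.
  move=> i0 t0; rewrite /E /space_error gtn_eqF//.
  by apply: ereal_sup_ubound; exists t.
have E0_ge0 : (0 <= E 0%N)%E.
  by apply: le_trans (uE 0 (lexx _)); rewrite lee_fin ET0.
have E_ge0 i : (0 < i <= p.+1)%N -> (0 <= E i)%E.
  move=> ip; have /andP[i0 ip1] := ip.
  apply: le_trans (iE i 0 i0 (lexx _)).
  by rewrite lee_fin addr_ge0 ?ET0// (spc_S_ge0 spc).
set D := sup_time _.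
have DE t : 0 <= t -> ((normL2 Omega (iter p.+1 dt u t))%:E <= D)%E.
  by move=> t0; apply: ereal_sup_ubound; exists t.
have D_ge0 : (0 <= D)%E.
  by apply: le_trans (DE 0 (lexx _)); rewrite lee_fin sqrtr_ge0.
pose xi k := normL2 Omega (Pi (u (k%:R * tau)) - uh k).
have split_error : normL2 Omega (u tn - uh n) <= ET 0%N tn + xi n.
  have L2u := reg_L2 reg (leq0n p.+1) (t_ge0 n).
  have VPiu := VPi _ (t_ge0 n).
  rewrite -(subrKA (Pi (u tn))).
  apply: le_trans (ler_seminormD sip _ _) _.
  - by apply: (subspaceB (sip_sub sip)) => //; exact: VL2.
  - by apply: VL2; apply: (subspaceB sV).
  by rewrite lerD2r; apply: (spc_T spc (leq0n p.+1) (t_ge0 n)).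
have xi0E : xi 0%N = normL2 Omega (Pi (u 0) - uh 0%N) by rewrite /xi mul0r.
set T := \sum_(1 <= i < p.+2) _.
have term_ge0 i : (0 < i <= p.+1)%N -> (0 <= (tau ^+ i.-1)%:E * E i)%E.
  by move=> ip; rewrite mule_ge0 ?E_ge0// lee_fin exprn_ge0.
have T_ge0 : (0 <= T)%E.
  by rewrite /T big_nat; apply: sume_ge0 => i; rewrite ltnS; exact: term_ge0.
have Dtau_ge0 : (0 <= D * (tau ^+ p)%:E)%E by rewrite mule_ge0// lee_fin exprn_ge0.
(* At [n = 0] the last term vanishes even if a supremum is infinite. *)
have [n0|n_gt0] := posnP n.
  move: split_error; rewrite /tn n0 mul0r => split_error.
  rewrite mulr0 expR0 mul1r sigma0 mulr0 mul0e adde0 -xi0E.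
  apply: le_trans (_ : (ET 0%N 0 + xi 0%N)%:E <= _)%E; first by rewrite lee_fin.
  by rewrite EFinD addeC leeD2l// uE.
have Cstar_gt0 : 0 < Cstar.
  rewrite /Cstar mulr_gt0// big_ord_recl ltr_pwDl//.
    by have [_ /(_ 0%N isT) -> _] := RK; rewrite fact0 invr1 normr1.
  by apply: sumr_ge0.
have sigma_pos : 0 < sigma mu tn by apply: sigma_gt0 => //; rewrite mulr_gt0// ltr0n.
have Cs_gt0 : 0 < Cstar * sigma mu tn by rewrite mulr_gt0.
(* From the first step on, an infinite supremum makes the bound infinite. *)
have [Xoo|Xfin] := eqVneq (T + D * (tau ^+ p)%:E)%E +oo%E.
  rewrite Xoo gt0_muley// addey ?leey// gt_eqF// (lt_le_trans (ltNyr 0))//.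
  by rewrite adde_ge0// lee_fin mulr_ge0 ?expR_ge0 ?sqrtr_ge0.
have [Eoo|Efin] := eqVneq (E 0%N) +oo%E.
  rewrite Eoo addey// addye ?leey// gt_eqF// (lt_le_trans (ltNyr 0))//.
  by rewrite mule_ge0 ?adde_ge0// lee_fin ltW.
have Tfin : T \is a fin_num.
  rewrite ge0_fin_numE// ltey; apply: contra_neq Xfin => ->.
  by rewrite addye// gt_eqF// (lt_le_trans (ltNyr 0)).
have Dfin : D \is a fin_num.
  rewrite ge0_fin_numE// ltey; apply: contra_neq Xfin => ->.
  rewrite gt0_mulye ?lte_fin ?exprn_gt0// addey// gt_eqF//.
  by rewrite (lt_le_trans (ltNyr 0)).
have Eifin i : (0 < i <= p.+1)%N -> E i \is a fin_num.
  move=> ip; rewrite ge0_fin_numE ?E_ge0// ltey.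
  apply: contraL Tfin => /eqP Ei; rewrite ge0_fin_numE// -leNgt leye_eq.
  rewrite /T big_nat; apply/eqP/esum_eqyP.
    by move=> j jp; rewrite gt_eqF// (lt_le_trans (ltNyr 0))// term_ge0.
  exists i; split; rewrite ?mem_index_iota//.
  by rewrite Ei gt0_muley// lte_fin exprn_gt0.
pose e i := fine (E i).
have TE : T = (\sum_(1 <= i < p.+2) tau ^+ i.-1 * e i)%:E.
  rewrite /T -sumEFin; apply: eq_big_nat => i ip.
  by rewrite EFinM /e fineK// Eifin.
set K := Cstar * (\sum_(1 <= i < p.+2) tau ^+ i.-1 * e i + fine D * tau ^+ p).
have K_ge0 : 0 <= K.
  rewrite mulr_ge0 ?(ltW Cstar_gt0)// -lee_fin EFinD -TE EFinM fineK//.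
  exact: adde_ge0.
have RKop : (opnorm Omega Vh (RK_step s alpha tau Lh) <= (1 + mu * tau)%:E)%E.
  exact: FS.
have step k : xi k.+1 <= (1 + mu * tau) * xi k + tau * K.
  set t := k%:R * tau.
  have tS : k.+1%:R * tau = t + tau by rewrite -addn1 natrD mulrDl mul1r.
  have t0 : 0 <= t by exact: t_ge0.
  have VPt := VPi t t0; have VPtS : Vh (Pi (u (t + tau))) by apply: VPi; rewrite addr_ge0.
  have -> : xi k.+1 = normL2 Omega
      (RK_step s alpha tau Lh (Pi (u t) - uh k) +
       (Pi (u (t + tau)) - RK_step s alpha tau Lh (Pi (u t)))).
    rewrite (linear_withinB lRK)// /xi tS uhS; congr normL2.
    by rewrite [in RHS]addrC addrA subrK.
  have Vxi : Vh (Pi (u t) - uh k) by exact: subspaceB.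
  have Vloc : Vh (Pi (u (t + tau)) - RK_step s alpha tau Lh (Pi (u t))).
    by apply: subspaceB => //; exact: VRK.
  apply: le_trans (ler_seminormD sip (VL2 _ (VRK _ Vxi)) (VL2 _ Vloc)) _.
  apply: lerD; first exact: (normL2_le_opnorm mO sV VL2 VRK lRK RKop).
  have eE i r : (0 < i <= p.+1)%N -> 0 <= r -> ES i r + ET i r <= e i.
    move=> ip r0; rewrite -lee_fin fineK ?Eifin// iE//.
    by case/andP: ip.
  have DE' r : 0 <= r -> normL2 Omega (iter p.+1 dt u r) <= fine D.
    by move=> r0; rewrite -lee_fin fineK// DE.
  have := truncation_error_le mO sV VL2 VLh lLh std reg spc RK tau01 lambda1
    CFL eE DE' t0.
  move/le_trans; apply; rewrite le_eqVlt; apply/orP; left; apply/eqP.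
  rewrite /K -/Cstar mulrCA; congr (_ * _); rewrite mulrDr mulr_sumr; congr (_ + _).
    by apply: eq_big_nat => -[|i]// _; rewrite mulrA -exprS.
  by rewrite exprS mulrCA mulrC mulrA.
have := discrete_gronwall mu0 tau_ge0 K_ge0 (fun k => sqrtr_ge0 _ : 0 <= xi k)
  step n.
rewrite -/tn xi0E => gronwall.
rewrite TE -(fineK Dfin) -(fineK (_ : E 0%N \is a fin_num)); last first.
  by rewrite ge0_fin_numE// ltey.
rewrite -!(EFinM, EFinD) lee_fin.
have E0n : ET 0%N tn <= fine (E 0%N).
  rewrite -lee_fin fineK ?ge0_fin_numE ?ltey//.
  exact/uE/t_ge0.
have -> : Cstar * sigma mu tn *
    (\sum_(1 <= i < p.+2) tau ^+ i.-1 * e i + fine D * tau ^+ p) =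
  K * sigma mu tn by rewrite /K mulrAC.
apply: le_trans split_error (le_trans (lerD E0n gronwall) _).
by rewrite addrCA addrA.
Qed.
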